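(* The resistance energies of the following graphs are: (i) if $G=K_n$, then $E_R(G)=\frac{4(n-1)}{n}$; (ii) if $G=C_n$, then $E_R(G)=\frac{n^2-1}{3}$; (iii) if $G=K_{n,n}$, then $E_R(G)=\frac{8n-6}{n}$.
   Context: $K_n$ is the complete graph on $n\geq 1$ vertices, $C_n$ the cycle on $n\ge 3$ vertices, and $K_{n,n}$ the complete bipartite graph with both parts of size $n\ge 1$. For a connected graph $G$ with vertices $v_1,\dots,v_m$, Laplacian matrix $L$ (degree matrix minus adjacency matrix) and Moore-Penrose inverse $L^\dagger=(l^\dagger_{ij})$, the resistance distance is $r_{ij}=l^\dagger_{ii}+l^\dagger_{jj}-2l^\dagger_{ij}$, and the resistance distance matrix is $R(G)=(r_{ij})_{m\times m}$. The resistance energy $E_R(G)$ is the sum of the absolute values of the eigenvalues of $R(G)$, counted with multiplicity. *)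

(* Defs.v *)
From HB Require Import structures.
From mathcomp Require Import all_boot all_order all_algebra zify.
From mathcomp Require Import complex.

Set Implicit Arguments.
Unset Strict Implicit.
Unset Printing Implicit Defensive.

Import Order.TTheory GRing.Theory Num.Theory.

Local Open Scope ring_scope.

(* A graph on the vertices 0, ..., m - 1 is given by its adjacency relation. *)

Definition simple_connected (m : nat) (e : rel 'I_m) : Prop :=
  [/\ symmetric e, irreflexive e & forall i j, connect e i j].

Definition complete_graph (n : nat) : rel 'I_n := fun i j => i != j.

(* [ordS] is the cyclic successor, i |-> i + 1 modulo n. *)
Definition cycle_graph (n : nat) : rel 'I_n :=
  fun i j => (j == ordS i) || (i == ordS j).

(* The two parts are {0, ..., n - 1} and {n, ..., 2n - 1}. *)
Definition complete_bipartite_graph (n : nat) : rel 'I_(n + n) :=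
  fun i j => (i < n)%N != (j < n)%N.

Lemma complete_graph_simple_connected n :
  simple_connected (@complete_graph n).
Proof.
split=> [i j | i | i j]; rewrite /complete_graph ?eqxx 1?eq_sym //.
by have [-> | ij] := eqVneq i j; [exact: connect0 | exact: connect1].
Qed.

Lemma cycle_graph_simple_connected n :
  (3 <= n)%N -> simple_connected (@cycle_graph n).
Proof.
move=> n3; have sym : symmetric (@cycle_graph n).
  by move=> i j; rewrite /cycle_graph orbC.
split=> // [i | i j].
  rewrite /cycle_graph orbb -val_eqE /=; have := ltn_ord i.
  rewrite leq_eqVlt => /predU1P[eq_i | lt_i]; last by rewrite modn_small; lia.
  by rewrite eq_i modnn; lia.
have n_gt0 : (0 < n)%N by lia.
have from0 (k : nat) (ltk : (k < n)%N) :
    connect (@cycle_graph n) (Ordinal n_gt0) (Ordinal ltk).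
  elim: k ltk => [|k IHk] ltk.
    by rewrite (_ : Ordinal ltk = Ordinal n_gt0) ?connect0 //; apply: val_inj.
  apply: connect_trans (IHk (ltnW ltk)) (connect1 _).
  by rewrite /cycle_graph -val_eqE /= modn_small ?eqxx.
have csym := sym_connect_sym sym.
case: i j => [i lti] [j ltj].
by apply: connect_trans (from0 j ltj); rewrite csym.
Qed.

Lemma complete_bipartite_graph_simple_connected n :
  simple_connected (@complete_bipartite_graph n).
Proof.
split=> [i j | i | i j]; rewrite /complete_bipartite_graph ?eqxx 1?eq_sym //.
have [eq_ij | neq_ij] := eqVneq (i < n)%N (j < n)%N; last exact: connect1.
have ltk : ((if i < n then n else 0) < n + n)%N.
  by have := ltn_ord i; case: ifP; lia.
apply: (@connect_trans _ _ (Ordinal ltk)); apply: connect1 => /=.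
  by case: ifP; rewrite ?ltnn //; have := ltn_ord i; lia.
by rewrite -eq_ij; case: ifP; rewrite ?ltnn //; have := ltn_ord i; lia.
Qed.

Section MoorePenrose.

Variable R : realFieldType.

(* For real matrices the conjugate transpose is the transpose. *)
Definition is_moore_penrose (m n : nat) (A : 'M[R]_(m, n)) (X : 'M[R]_(n, m)) :
    bool :=
  [&& A *m X *m A == A, X *m A *m X == X,
      (A *m X)^T == A *m X & (X *m A)^T == X *m A].

Lemma gram_unit (m n : nat) (B : 'M[R]_(m, n)) :
  row_free B -> B *m B^T \in unitmx.
Proof.
move=> freeB; rewrite -row_free_unit; apply: inj_row_free => v vBB.
have {vBB} vBB : (v *m B) *m (v *m B)^T = 0.
  by rewrite trmx_mul mulmxA -(mulmxA v) vBB mul0mx.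
have vB0 : v *m B = 0.
  move: (v *m B) vBB => w ww; apply/rowP=> j.
  have : \sum_k w 0 k ^+ 2 == 0.
    move/matrixP/(_ 0 0): ww; rewrite !mxE => w2.
    by apply/eqP; rewrite -[RHS]w2; apply: eq_bigr => k _; rewrite mxE.
  rewrite psumr_eq0 => [/allP/(_ j) | k _]; last exact: sqr_ge0.
  by rewrite mem_index_enum sqrf_eq0 mxE => /(_ isT)/eqP.
by apply: (row_free_inj freeB); rewrite vB0 mul0mx.
Qed.

Lemma moore_penrose_exists (m n : nat) (A : 'M[R]_(m, n)) :
  exists X, is_moore_penrose A X.
Proof.
rewrite -(mulmx_base A).
have := gram_unit (row_base_free A).
have := @gram_unit _ _ (col_base A)^T; rewrite trmxK /row_free mxrank_tr.
move/(_ (col_base_full A)).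
move: (\rank A) (col_base A) (row_base A) => r B C uB uC.
have symI k (M : 'M[R]_k) : M^T = M -> (invmx M)^T = invmx M.
  by move=> sM; rewrite trmx_inv sM.
have sC : (invmx (C *m C^T))^T = invmx (C *m C^T).
  by apply: symI; rewrite trmx_mul trmxK.
have sB : (invmx (B^T *m B))^T = invmx (B^T *m B).
  by apply: symI; rewrite trmx_mul trmxK.
pose X := C^T *m invmx (C *m C^T) *m (invmx (B^T *m B) *m B^T).
have AX : B *m C *m X = B *m invmx (B^T *m B) *m B^T.
  by rewrite /X -!mulmxA (mulmxA C) mulKVmx // -mulmxA.
have XA : X *m (B *m C) = C^T *m invmx (C *m C^T) *m C.
  by rewrite /X -!mulmxA (mulmxA B^T) mulKmx.
exists X; apply/and4P; split; apply/eqP.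
- by rewrite AX -!mulmxA (mulmxA B^T B C) mulKmx.
- by rewrite XA /X -!mulmxA (mulmxA C C^T) mulKVmx.
- by rewrite AX !trmx_mul trmxK sB mulmxA.
- by rewrite XA !trmx_mul trmxK sC mulmxA.
Qed.

Lemma moore_penrose_unique (m n : nat) (A : 'M[R]_(m, n)) X Y :
  is_moore_penrose A X -> is_moore_penrose A Y -> X = Y.
Proof.
case/and4P=> /eqP AXA /eqP XAX /eqP sAX /eqP sXA.
case/and4P=> /eqP AYA /eqP YAY /eqP sAY /eqP sYA.
have AXY : A *m X = A *m Y.
  by rewrite -sAX -{1}AYA -mulmxA trmx_mul sAX sAY mulmxA AXA.
have XYA : X *m A = Y *m A.
  by rewrite -sXA -{1}AYA -mulmxA mulmxA trmx_mul sYA sXA -mulmxA (mulmxA A) AXA.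
by rewrite -XAX XYA -mulmxA AXY mulmxA YAY.
Qed.

Definition moore_penrose (m n : nat) (A : 'M[R]_(m, n)) : 'M[R]_(n, m) :=
  xchoose (moore_penrose_exists A).

Lemma moore_penroseP (m n : nat) (A : 'M[R]_(m, n)) :
  is_moore_penrose A (moore_penrose A).
Proof. exact: xchooseP. Qed.

End MoorePenrose.

Section Resistance.

Variables (R : rcfType) (m : nat).

Definition degree (e : rel 'I_m) (i : 'I_m) : nat := #|[pred j | e i j]|.

Definition degree_matrix (e : rel 'I_m) : 'M[R]_m :=
  diag_mx (\row_i (degree e i)%:R).

Definition adjacency_matrix (e : rel 'I_m) : 'M[R]_m :=
  \matrix_(i, j) (e i j)%:R.

Definition laplacian (e : rel 'I_m) : 'M[R]_m :=
  degree_matrix e - adjacency_matrix e.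

Definition resistance_matrix (e : rel 'I_m) : 'M[R]_m :=
  let Ld := moore_penrose (laplacian e) in
  \matrix_(i, j) (Ld i i + Ld j j - 2 * Ld i j).

(* The list of the m complex roots of the characteristic polynomial, each
   repeated according to its multiplicity. *)
Definition eigenvalues (A : 'M[R]_m) : seq R[i] :=
  sval (closed_field_poly_normal (char_poly (map_mx (real_complex R) A))).

Lemma eigenvaluesP (A : 'M[R]_m) :
  char_poly (map_mx (real_complex R) A) =
    \prod_(z <- eigenvalues A) ('X - z%:P).
Proof.
rewrite /eigenvalues; case: closed_field_poly_normal => s /= {1}->.
by rewrite (monicP (char_poly_monic _)) scale1r.
Qed.

Lemma size_eigenvalues (A : 'M[R]_m) : size (eigenvalues A) = m.
Proof.
apply: succn_inj; rewrite -(size_char_poly (map_mx (real_complex R) A)).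
by rewrite eigenvaluesP size_prod_XsubC.
Qed.

(* [ComplexField.Normc.normc] is the modulus, as an element of R. *)
Definition resistance_energy (e : rel 'I_m) : R :=
  \sum_(z <- eigenvalues (resistance_matrix e)) ComplexField.Normc.normc z.

End Resistance.

Arguments resistance_energy R {m} e.

(* Main.v *)
Require Import Defs.
From mathcomp Require Import all_boot all_order all_algebra.
From mathcomp Require Import complex ring lra zify.

Set Implicit Arguments.
Unset Strict Implicit.
Unset Printing Implicit Defensive.

Import Order.TTheory GRing.Theory Num.Theory.

Local Open Scope ring_scope.

(** Let L be the Laplacian of a connected graph on m vertices, X its
    Moore-Penrose inverse and J the all-ones matrix. In the three families all
    diagonal entries of X are equal, say to d, so the resistance matrix is
    2 d J - 2 X. The two terms annihilate each other because X J = 0, so up to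
    zeros the spectrum of the resistance matrix is the union of those of 2 d J
    and - 2 X ([energyD]). The first is positive semidefinite and the second
    negative semidefinite, since X = X L X and L is positive semidefinite;
    hence the moduli of their eigenvalues add up to the traces of 2 d J and 2 X
    ([energy_psd], [energy_nsd]), and both traces are 2 m d. Thus the resistance
    energy is 4 m d ([resistance_energy_const_diag]).

    It remains to exhibit X, which is characterised by being symmetric with zero
    row sums and satisfying L X = I - J / m ([moore_penrose_laplacian]). For the
    complete graph, X = (I - J / n) / n. For the cycle, the off-diagonal entries
    come from the resistance distance k (n - k) / n between vertices k steps
    apart. For the complete bipartite graph, they take one value inside a part
    and another across the parts. *)

(** * Sum of the moduli of the eigenvalues *)

Section MatrixEnergy.

Variable R : rcfType.

(** The sum of the moduli of the complex eigenvalues, counted with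
    multiplicity. *)
Definition energy (m : nat) (A : 'M[R]_m) : R :=
  \sum_(z <- eigenvalues A) ComplexField.Normc.normc z.

(** Nonnegativity of the quadratic form; symmetry is not part of the
    definition. *)
Definition psd (m : nat) (A : 'M[R]_m) : Prop :=
  forall x : 'rV_m, 0 <= (x *m A *m x^T) 0 0.

Lemma mul_row_tr (m : nat) (x : 'rV[R]_m) :
  (x *m x^T) 0 0 = \sum_j x 0 j ^+ 2.
Proof. by rewrite mxE; apply: eq_bigr => j _; rewrite mxE. Qed.

Lemma sum_eigenvalues (m : nat) (A : 'M[R]_m) :
  \sum_(z <- eigenvalues A) z = (real_complex R (\tr A)).
Proof.
case: m A => [|m] A.
  have /size0nil -> : size (eigenvalues A) = 0%N by rewrite size_eigenvalues.
  by rewrite big_nil /mxtrace big_ord0 rmorph0.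
have sz : size (eigenvalues A) != 0%N by rewrite size_eigenvalues.
have := coefPn_prod_XsubC sz.
rewrite size_eigenvalues -eigenvaluesP char_poly_trace // => /oppr_inj <-.
by rewrite /mxtrace rmorph_sum; apply: eq_bigr => i _; rewrite mxE.
Qed.

Lemma mem_eigenvalues (m : nat) (A : 'M[R]_m) (z : R[i]) :
  (z \in eigenvalues A) = eigenvalue (map_mx (real_complex R) A) z.
Proof. by rewrite -root_prod_XsubC -eigenvaluesP -eigenvalue_root_char. Qed.

(** Both facts come from evaluating the bilinear form of [A] at the real and
    imaginary parts of an eigenvector [a + i b] with eigenvalue [x + i y]:
    [a A a^T + b A b^T], which is nonnegative, is [x] times the squared norm, and
    [b A a^T - a A b^T], which is zero by symmetry, is [y] times it. *)
Lemma psd_eigenvalue (m : nat) (A : 'M[R]_m) (z : R[i]) :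
  A^T = A -> psd A -> z \in eigenvalues A ->
  (0 <= complex.Re z) /\ complex.Im z = 0.
Proof.
move=> symA psdA; rewrite mem_eigenvalues => /eigenvalueP[v].
case: z => x y /= vA v_neq0.
pose a := map_mx (@complex.Re R) v; pose b := map_mx (@complex.Im R) v.
have vE j : v 0 j = Complex (a 0 j) (b 0 j) by rewrite !mxE; case: (v 0 j).
clearbody a b.
have vAE j : Complex ((a *m A) 0 j) ((b *m A) 0 j)
             = Complex (x * a 0 j - y * b 0 j) (x * b 0 j + y * a 0 j).
  move/rowP/(_ j): vA; rewrite [RHS]mxE vE => vAj.
  rewrite -[RHS]/(Complex x y * Complex (a 0 j) (b 0 j)) -vAj !mxE.
  rewrite (eq_bigr (fun k => Complex (a 0 k * A k j) (b 0 k * A k j))).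
    by elim/big_rec3: _ => [|k r1 r2 r3 _ <-].
  by move=> k _; rewrite vE mxE; simpc.
have aA : a *m A = x *: a - y *: b.
  by apply/rowP=> j; case: (vAE j) => -> _; rewrite !mxE.
have bA : b *m A = x *: b + y *: a.
  by apply/rowP=> j; case: (vAE j) => _ ->; rewrite !mxE.
have trE (M : 'M[R]_1) : M 0 0 = M^T 0 0 by rewrite mxE.
have ab : (a *m b^T) 0 0 = (b *m a^T) 0 0.
  by rewrite [LHS]trE trmx_mul trmxK.
have aAb : (a *m A *m b^T) 0 0 = (b *m A *m a^T) 0 0.
  by rewrite [LHS]trE !trmx_mul trmxK symA mulmxA.
have n2_gt0 : 0 < (a *m a^T) 0 0 + (b *m b^T) 0 0.
  rewrite !mul_row_tr -big_split /= lt0r sumr_ge0 ?andbT; last first.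
    by move=> j _; rewrite addr_ge0 ?sqr_ge0.
  apply: contraNneq v_neq0 => s0; apply/eqP/rowP=> j; rewrite vE !mxE.
  have /eqP := s0; rewrite psumr_eq0; last first.
    by move=> k _; rewrite addr_ge0 ?sqr_ge0.
  move/allP/(_ j); rewrite mem_index_enum => /(_ isT).
  by rewrite paddr_eq0 ?sqr_ge0 // !sqrf_eq0 => /andP[/eqP-> /eqP->].
have := addr_ge0 (psdA a) (psdA b).
move: aAb; rewrite aA bA !mulmxDl !mulNmx -!scalemxAl.
move: n2_gt0 ab; move: (a *m a^T) (b *m b^T) (a *m b^T) (b *m a^T).
move=> aa bb ab ba; rewrite !mxE => n2_gt0 -> yE xE; split.
  by rewrite -(pmulr_lge0 _ n2_gt0); lra.
apply/eqP; move: n2_gt0 yE; case: (eqVneq y 0) => // y0 n2 yE.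
have : y * (aa 0 0 + bb 0 0) = 0 by lra.
by move/eqP; rewrite mulf_eq0 (negPf y0) gt_eqF.
Qed.

Lemma energy_psd (m : nat) (A : 'M[R]_m) : A^T = A -> psd A -> energy A = \tr A.
Proof.
move=> symA psdA; apply: (@complexI R); rewrite -sum_eigenvalues.
rewrite /energy rmorph_sum /=; apply: eq_big_seq => z.
move/(psd_eigenvalue symA psdA); case: z => x y /= [x_ge0 ->].
by rewrite expr0n addr0 sqrtr_sqr ger0_norm.
Qed.

Lemma energy_nsd (m : nat) (A : 'M[R]_m) :
  A^T = A -> psd A -> energy (- A) = \tr A.
Proof.
move=> symA psdA; apply: (@complexI R).
have -> : real_complex R (\tr A) = - \sum_(z <- eigenvalues (- A)) z.
  by rewrite sum_eigenvalues !raddfN /= opprK.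
rewrite /energy rmorph_sum -sumrN /=; apply: eq_big_seq => z.
rewrite mem_eigenvalues => /eigenvalueP[v vA v0].
have /(psd_eigenvalue symA psdA) : - z \in eigenvalues A.
  rewrite mem_eigenvalues; apply/eigenvalueP; exists v => //.
  by rewrite scaleNr -vA map_mxN mulmxN opprK.
case: z {vA} => x y /= [x_le0 /eqP]; rewrite oppr_eq0 => /eqP ->.
rewrite expr0n addr0 sqrtr_sqr -normrN ger0_norm //.
by apply/eqP; rewrite eq_complex /= oppr0 !eqxx.
Qed.

(** The characteristic matrices satisfy
    [('X - A) ('X - B) = 'X ('X - (A + B))] when [A B = 0], so the nonzero
    eigenvalues of [A + B] are the nonzero ones of [A] together with the nonzero
    ones of [B]. *)
Lemma energyD (m : nat) (A B : 'M[R]_m) :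
  A *m B = 0 -> energy (A + B) = energy A + energy B.
Proof.
move=> AB0.
(* The [m] zeros account for the factor ['X] of the determinant. *)
suff pe : perm_eq (nseq m 0 ++ eigenvalues (A + B))
                   (eigenvalues A ++ eigenvalues B).
  rewrite /energy -big_cat -(perm_big _ pe) big_cat /=.
  have -> : \sum_(z <- nseq m 0) ComplexField.Normc.normc z = 0 :> R.
    apply: big1_seq => z /andP[_ /nseqP[-> _]].
    by rewrite ComplexField.Normc.normc0.
  by rewrite add0r.
apply: prod_XsubC_eq; rewrite !big_cat /= -!eigenvaluesP big_nseq subr0.
rewrite -/('X) iter_mulr_1 /char_poly -det_scalar -!det_mulmx; congr (\det _).
rewrite /char_poly_mx !map_mxD; set A' := map_mx _ _; set B' := map_mx _ _.
have AB0' : A' *m B' = 0 by rewrite -!map_mxM AB0 !map_mx0.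
rewrite mulmxBl !mulmxBr AB0' subr0 mulmxDr opprD addrA addrAC.
by rewrite (scalar_mxC _ A').
Qed.

End MatrixEnergy.

(** * Laplacians and resistance energy *)

Section ResistanceEnergy.

Variables (R : rcfType) (m : nat).

Local Notation laplacian := (laplacian R).
Local Notation J := (const_mx 1 : 'M[R]_m).

Lemma mul_laplacianE (e : rel 'I_m) p (X : 'M[R]_(m, p)) i j :
  (laplacian e *m X) i j = \sum_(k | e i k) (X i j - X k j).
Proof.
rewrite /laplacian mulmxBl mul_diag_mx sumrB !mxE sumr_const mulr_natl.
congr (_ - _); rewrite [RHS]big_mkcond /=; apply: eq_bigr => k _.
by rewrite mxE; case: (e i k); rewrite ?mul1r ?mul0r.
Qed.

Lemma tr_laplacian (e : rel 'I_m) :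
  symmetric e -> (laplacian e)^T = laplacian e.
Proof.
move=> sym_e; apply/matrixP=> i j; rewrite !mxE sym_e eq_sym.
by case: eqP => // ->.
Qed.

(** Twice the quadratic form of the Laplacian is the sum of [(x_i - x_k)^2] over
    ordered pairs of adjacent vertices. *)
Lemma psd_laplacian (e : rel 'I_m) : symmetric e -> psd (laplacian e).
Proof.
move=> sym_e x.
have xLx : (x *m laplacian e *m x^T) 0 0
         = \sum_i \sum_(k | e i k) x 0 i * (x 0 i - x 0 k).
  rewrite -mulmxA mxE; apply: eq_bigr => i _; rewrite mul_laplacianE mulr_sumr.
  by apply: eq_bigr => k _; rewrite !mxE.
rewrite -(pmulr_lge0 _ (ltr0Sn R 1)) mulr_natr mulr2n {2}xLx.
rewrite (exchange_big_dep xpredT) //= xLx -big_split /= sumr_ge0 // => i _.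
rewrite [X in _ + X](eq_bigl (e i)) => [|k]; last exact: sym_e.
rewrite -big_split /= sumr_ge0 // => k _.
have -> : x 0 i * (x 0 i - x 0 k) + x 0 k * (x 0 k - x 0 i)
        = (x 0 i - x 0 k) ^+ 2 by ring.
exact: sqr_ge0.
Qed.

(** These conditions force [X] to commute with the Laplacian, both products
    being the orthogonal projection onto the complement of the constants. *)
Lemma moore_penrose_laplacian (e : rel 'I_m) (X : 'M[R]_m) :
    symmetric e -> X^T = X -> X *m J = 0 ->
    laplacian e *m X = 1%:M - m%:R^-1 *: J ->
  moore_penrose (laplacian e) = X.
Proof.
move=> sym_e symX XJ0 LX; apply: moore_penrose_unique (moore_penroseP _) _.
have symL := tr_laplacian sym_e.
have trJ : J^T = J by rewrite trmx_const.
have LJ0 : laplacian e *m J = 0.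
  apply/matrixP=> i j; rewrite mul_laplacianE big1 ?mxE // => k _.
  by rewrite !mxE subrr.
have symLX : (laplacian e *m X)^T = laplacian e *m X.
  by rewrite LX linearB linearZ /= trJ trmx1.
have XL : X *m laplacian e = laplacian e *m X.
  by rewrite -[RHS]symLX trmx_mul symX symL.
apply/and4P; rewrite XL symLX; split=> //; apply/eqP.
  by rewrite -mulmxA XL LX mulmxBr mulmx1 -scalemxAr LJ0 scaler0 subr0.
by rewrite -XL -mulmxA LX mulmxBr mulmx1 -scalemxAr XJ0 scaler0 subr0.
Qed.

Lemma psd_ones : psd J.
Proof.
move=> x; pose u : 'cV[R]_m := const_mx 1.
have -> : J = u *m u^T.
  by apply/matrixP=> i j; rewrite !mxE big_ord1 !mxE mulr1.
have -> : x *m (u *m u^T) *m x^T = (x *m u) *m (x *m u)^T.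
  by rewrite trmx_mul !mulmxA.
by rewrite mul_row_tr sumr_ge0 // => i _; exact: sqr_ge0.
Qed.

(** The graph is not assumed connected: the hypothesis on the product of the
    Laplacian and [X] forces the kernel of the Laplacian to consist of constants. *)
Lemma resistance_energy_const_diag (e : rel 'I_m) (X : 'M[R]_m) (d : R) :
    symmetric e -> X^T = X -> X *m J = 0 ->
    laplacian e *m X = 1%:M - m%:R^-1 *: J ->
    (forall i, X i i = d) ->
  resistance_energy R e = 4 * m%:R * d.
Proof.
move=> sym_e symX XJ0 LX diagX.
have XLX : X *m laplacian e *m X = X.
  by rewrite -mulmxA LX mulmxBr mulmx1 -scalemxAr XJ0 scaler0 subr0.
have psdX : psd X.
  move=> x; have := psd_laplacian sym_e (x *m X).
  rewrite trmx_mul symX !mulmxA.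
  by rewrite -[x *m X *m _]mulmxA -[x *m _ *m X]mulmxA XLX.
(* A nonzero [x] provides a vertex, hence [0 <= d]; nothing bounds [d] below when
   [m = 0]. *)
have psdJ : psd ((2 * d) *: J).
  move=> x; have [-> | /rV0Pn[i _]] := eqVneq x 0.
    by rewrite !mul0mx mxE.
  have d_ge0 : 0 <= d.
    have := psdX (delta_mx 0 i).
    by rewrite -rowE trmx_delta -colE !mxE diagX.
  by rewrite -scalemxAr -scalemxAl mxE mulr_ge0 ?psd_ones // mulr_ge0.
have -> : resistance_energy R e = energy ((2 * d) *: J + - (2 *: X)).
  rewrite /resistance_energy /energy; congr (\sum_(z <- eigenvalues _) _).
  rewrite /resistance_matrix (moore_penrose_laplacian sym_e symX XJ0 LX).
  by apply/matrixP=> i j; rewrite !mxE !diagX; ring.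
have JX0 : J *m X = 0.
  by rewrite -symX -(trmx_const _ _ (1 : R)) -trmx_mul XJ0 trmx0.
rewrite energyD; last first.
  by rewrite mulmxN -scalemxAr -scalemxAl JX0 !scaler0 oppr0.
rewrite energy_psd //; last by rewrite linearZ /= trmx_const.
rewrite energy_nsd; first last.
- by move=> x; rewrite -scalemxAr -scalemxAl mxE mulr_ge0.
- by rewrite linearZ /= symX.
have tr_const (Y : 'M[R]_m) c : (forall i, Y i i = c) -> \tr Y = m%:R * c.
  move=> Yc; rewrite /mxtrace (eq_bigr (fun=> c)) => [|i _]; last exact: Yc.
  by rewrite sumr_const card_ord mulr_natl.
rewrite !mxtraceZ (tr_const X d) // (tr_const J 1) => [|i]; last exact: mxE.
ring.
Qed.

End ResistanceEnergy.

(** The preceding criterion for the matrix with entries [f i j]: the fourth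
    hypothesis says that the Laplacian sends its [j]-th column to the [j]-th unit
    vector minus the mean of that vector. *)
Lemma resistance_energy_entries (R : rcfType) (m : nat) (e : rel 'I_m)
    (f : 'I_m -> 'I_m -> R) (d : R) :
    symmetric e -> (forall i j, f i j = f j i) ->
    (forall i, \sum_j f i j = 0) ->
    (forall i j, \sum_(k | e i k) (f i j - f k j) = (i == j)%:R - m%:R^-1) ->
    (forall i, f i i = d) ->
  resistance_energy R e = 4 * m%:R * d.
Proof.
move=> sym_e sym_f f0 Lf fd.
apply: (@resistance_energy_const_diag _ _ _ (\matrix_(i, j) f i j)) => //.
- by apply/matrixP=> i j; rewrite !mxE sym_f.
- apply/matrixP=> i j; rewrite !mxE -[RHS](f0 i).
  by apply: eq_bigr => k _; rewrite !mxE mulr1.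
- apply/matrixP=> i j; rewrite mul_laplacianE !mxE mulr1 -Lf.
  by apply: eq_bigr => k _; rewrite !mxE.
- by move=> i; rewrite mxE.
Qed.

Lemma sumr_delta (R : nzRingType) (I : finType) (P : pred I) (i : I) :
  \sum_(k | P k) (k == i)%:R = (P i)%:R :> R.
Proof.
rewrite big_mkcond (bigD1 i) //= eqxx big1 ?addr0; first by case: (P i).
by move=> k /negPf ->; case: ifP.
Qed.

Lemma sumr_const_natl (R : nzRingType) (I : finType) (P : pred I) (c : R) :
  \sum_(k | P k) c = #|P|%:R * c.
Proof. by rewrite sumr_const mulr_natl. Qed.

(** * Complete graphs *)

Lemma resistance_energy_complete (R : rcfType) (n : nat) :
  (0 < n)%N ->
  resistance_energy R (@complete_graph n) = 4 * (n%:R - 1) / n%:R.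
Proof.
move=> n_gt0; have n0 : n%:R != 0 :> R by rewrite pnatr_eq0 -lt0n.
have [sym_e _ _] := complete_graph_simple_connected n.
pose f (i j : 'I_n) : R := ((j == i)%:R - n%:R^-1) / n%:R.
rewrite (@resistance_energy_entries R n _ f ((1 - n%:R^-1) / n%:R)) //.
- by field.
- by move=> i j; rewrite /f eq_sym.
- move=> i; rewrite -mulr_suml sumrB sumr_delta sumr_const_natl card_ord.
  by rewrite mulfV // subrr mul0r.
- move=> i j.
  have -> : \sum_(k | complete_graph i k) (f i j - f k j)
            = \sum_k ((j == i)%:R - (k == j)%:R) / n%:R.
    rewrite big_mkcond; apply: eq_bigr => k _.
    rewrite /complete_graph /f (eq_sym k j).
    by case: eqVneq => [<- | _] /=; [rewrite subrr mul0r | field].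
  rewrite -mulr_suml sumrB sumr_delta sumr_const_natl card_ord eq_sym /=.
  by field.
- by move=> i; rewrite /f eqxx.
Qed.

(** * Cycles *)

(** For [n = 1] or [n = 2] the successor and the predecessor coincide. *)
Lemma sum_cycle_graph (V : nmodType) (n : nat) (i : 'I_n) (F : 'I_n -> V) :
  (3 <= n)%N ->
  \sum_(k | cycle_graph i k) F k = F (ordS i) + F (ord_pred i).
Proof.
move=> n_ge3; have pred_neq_succ : ord_pred i != ordS i.
  rewrite -val_eqE /=; have lt_i := ltn_ord i.
  have [i0 | i_gt0] := posnP i.
    by rewrite i0 add0n !modn_small; lia.
  rewrite (_ : (i + n).-1 = i.-1 + n)%N ?modnDr; last by lia.
  rewrite modn_small; last by lia.
  have [in_eq | ] := eqVneq i.+1 n; first by rewrite in_eq modnn; lia.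
  by move=> ?; rewrite modn_small; lia.
have pred_eq k : (i == ordS k) = (k == ord_pred i).
  by rewrite eq_sym -{1}(ord_predK i) (inj_eq (can_inj (@ordSK n))).
rewrite (bigD1 (ordS i)) /cycle_graph ?eqxx //=; congr (_ + _).
apply: big_pred1 => k /=; rewrite pred_eq andb_orl andbN /=.
by have [-> | //] := eqVneq k (ord_pred i); rewrite pred_neq_succ.
Qed.

(** The product of the lengths of the two arcs between the points [a] and [b]
    of a circle of length [n], for [a] and [b] on the line at distance at most
    [n]; the resistance distance in the [n]-cycle is this product divided by
    [n]. *)
Definition arc_product (R : realDomainType) (n a b : R) : R :=
  `|a - b| * (n - `|a - b|).

(** The formula for the product is unaffected when the successor of [n - 1], or
    the predecessor of [0], is left unreduced modulo [n]: the two arcs swap. *)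
Lemma arc_product_succ (R : realDomainType) (n : nat) (i j : 'I_n) :
  arc_product (n%:R : R) (ordS i)%:R j%:R = arc_product n%:R (i%:R + 1) j%:R.
Proof.
have lt_i := ltn_ord i; rewrite /= natr1.
have [in_eq | neq] := eqVneq i.+1 n; last by rewrite modn_small //; lia.
have le_j : (j%:R : R) <= n%:R by rewrite ler_nat ltnW.
rewrite in_eq modnn /arc_product sub0r normrN !ger0_norm ?subr_ge0 //.
ring.
Qed.

Lemma arc_product_pred (R : realDomainType) (n : nat) (i j : 'I_n) :
  arc_product (n%:R : R) (ord_pred i)%:R j%:R
  = arc_product n%:R (i%:R - 1) j%:R.
Proof.
have lt_i := ltn_ord i; rewrite /=.
have [i0 | i_gt0] := posnP i; last first.
  rewrite (_ : (i + n).-1 = i.-1 + n)%N ?modnDr; last by lia.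
  by rewrite modn_small; [rewrite -{2}(prednK i_gt0) -natr1 addrK | lia].
have le_j : (j%:R : R) <= n.-1%:R by rewrite ler_nat; have := ltn_ord j; lia.
rewrite i0 add0n modn_small; last by lia.
have nE : n%:R = n.-1%:R + 1 :> R by rewrite natr1 prednK //; lia.
have j_ge0 : (0 : R) <= j%:R by [].
rewrite /arc_product nE ger0_norm ?subr_ge0 // ler0_norm; last by lra.
ring.
Qed.

(** The product is [n |a - b| - (a - b)^2]; as a function of an integer [a], the
    second difference of the square is [2], and that of the absolute value is [2]
    at [b] and zero elsewhere. *)
Lemma arc_product_diff2 (R : realDomainType) (n i j : nat) :
  arc_product (n%:R : R) (i%:R + 1) j%:R + arc_product n%:R (i%:R - 1) j%:R
  - 2 * arc_product n%:R i%:R j%:R = 2 * n%:R * (i == j)%:R - 2.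
Proof.
rewrite /arc_product; have [lt_ij | lt_ji | ->] := ltngtP i j.
- have : (i%:R + 1 : R) <= j%:R by rewrite natr1 ler_nat.
  by move=> ?; rewrite !ler0_norm; [rewrite /=; ring | lra..].
- have : (j%:R + 1 : R) <= i%:R by rewrite natr1 ler_nat.
  by move=> ?; rewrite !ger0_norm; [rewrite /=; ring | lra..].
- have -> : j%:R + 1 - j%:R = 1 :> R by ring.
  have -> : j%:R - 1 - j%:R = - 1 :> R by ring.
  by rewrite subrr normr0 normrN normr1 /=; ring.
Qed.

Lemma sum_arc_product (R : realFieldType) (n : nat) (i : 'I_n) :
  \sum_(j < n) arc_product (n%:R : R) i%:R j%:R = n%:R * (n%:R ^+ 2 - 1) / 6.
Proof.
(* [H (t + 1) - H t = t * (n - t)], so both parts of the sum, below and above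
   [i], telescope. *)
pose H (t : R) := n%:R * t * (t - 1) / 2 - t * (t - 1) * (2 * t - 1) / 6.
have lt_i := ltn_ord i.
rewrite -(big_mkord xpredT (fun j => arc_product n%:R i%:R j%:R)) /=.
rewrite (big_cat_nat (n := i)) //=; last exact: ltnW.
rewrite (eq_big_nat _ _ (F2 := fun j =>
    (- H (i%:R - j.+1%:R + 1)) - (- H (i%:R - j%:R + 1)))); last first.
  move=> j /andP[_ lt_ji]; rewrite /arc_product ger0_norm; last first.
    by rewrite subr_ge0 ler_nat ltnW.
  by rewrite -natr1 /H; field.
rewrite [X in _ + X](eq_big_nat _ _
  (F2 := fun j => H (j.+1%:R - i%:R) - H (j%:R - i%:R))); last first.
  move=> j /andP[le_ij _]; rewrite /arc_product ler0_norm; last first.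
    by rewrite subr_le0 ler_nat.
  by rewrite -natr1 /H; field.
rewrite (telescope_sumr (fun j => - H (i%:R - j%:R + 1))) //.
rewrite (telescope_sumr (fun j => H (j%:R - i%:R))); last exact: ltnW.
by rewrite /H; field.
Qed.

Lemma resistance_energy_cycle (R : rcfType) (n : nat) :
  (3 <= n)%N ->
  resistance_energy R (@cycle_graph n) = (n%:R ^+ 2 - 1) / 3.
Proof.
move=> n_ge3; have n0 : n%:R != 0 :> R by rewrite pnatr_eq0; lia.
have [sym_e _ _] := cycle_graph_simple_connected n_ge3.
(* The value of [d] makes the rows of [f] sum to zero. *)
pose d : R := (n%:R ^+ 2 - 1) / (12 * n%:R).
pose f (i j : 'I_n) : R := d - arc_product n%:R i%:R j%:R / (2 * n%:R).
rewrite (@resistance_energy_entries R n _ f d) //.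
- by rewrite /d; field.
- by move=> i j; rewrite /f /arc_product distrC.
- move=> i; rewrite /f sumrB sumr_const_natl card_ord -mulr_suml.
  by rewrite sum_arc_product /d; field.
- move=> i j; rewrite sum_cycle_graph // /f arc_product_succ arc_product_pred.
  have := arc_product_diff2 R n i j; rewrite val_eqE => diff2.
  set a := arc_product _ i%:R _; rewrite -/a in diff2.
  set b := arc_product _ (_ + _) _ in diff2 *.
  have -> : arc_product n%:R (i%:R - 1) j%:R
            = 2 * n%:R * (i == j)%:R - 2 + 2 * a - b :> R.
    by rewrite -diff2; ring.
  by field.
- by move=> i; rewrite /f /arc_product subrr normr0 !mul0r subr0.
Qed.

(** * Complete bipartite graphs *)

Lemma card_bipartition (n : nat) (b : bool) :
  #|[pred k : 'I_(n + n) | b != (k < n)%N]| = n.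
Proof.
rewrite -sum1_card big_split_ord /= big_mkcond [X in (_ + X)%N]big_mkcond /=.
rewrite (eq_bigr (fun=> ~~ b : nat)) => [|i _]; last first.
  by rewrite inE /= ltn_ord; case: b.
rewrite [X in (_ + X)%N](eq_bigr (fun=> b : nat)) => [|i _]; last first.
  by rewrite inE /= ltnNge leq_addr; case: b.
by rewrite !sum_nat_const card_ord -mulnDr; case: b; rewrite muln1.
Qed.

Lemma resistance_energy_complete_bipartite (R : rcfType) (n : nat) :
  (0 < n)%N ->
  resistance_energy R (@complete_bipartite_graph n) = (8 * n%:R - 6) / n%:R.
Proof.
move=> n_gt0; have n0 : n%:R != 0 :> R by rewrite pnatr_eq0 -lt0n.
have [sym_e _ _] := complete_bipartite_graph_simple_connected n.
have nn : (n + n)%:R = 2 * n%:R :> R by rewrite natrD; ring.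
(* Off the diagonal [f] is [- 3 / (4 n^2)] inside a part and [- 1 / (4 n^2)]
   across the parts. *)
pose p (i : 'I_(n + n)) := (i < n)%N.
pose f (i j : 'I_(n + n)) : R :=
  (j == i)%:R / n%:R - (3 - 2 * (p i != p j)%:R) / (4 * n%:R ^+ 2).
have card_p b : #|[pred k | b != p k]| = n by exact: card_bipartition.
rewrite (@resistance_energy_entries R _ _ f
           (n%:R^-1 - 3 / (4 * n%:R ^+ 2))) //.
- by rewrite nn; field.
- by move=> i j; rewrite /f eq_sym [p i == _]eq_sym.
- move=> i; rewrite sumrB -!mulr_suml sumr_delta sumrB -mulr_sumr.
  have -> : \sum_j (p i != p j)%:R = n%:R :> R.
    rewrite -[n in RHS](card_p (p i)) -sum1_card natr_sum [RHS]big_mkcond /=.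
    by apply: eq_bigr => k _; rewrite inE; case: (_ != _).
  rewrite sumr_const_natl card_ord nn /=.
  by field.
- move=> i j.
  (* A neighbour [k] of [i] is in the same part as [j] iff [i] is not. *)
  rewrite (eq_bigr (fun k => (f i j
      + (3 - 2 * (p i == p j)%:R) / (4 * n%:R ^+ 2)) - (k == j)%:R / n%:R)).
    rewrite sumrB -mulr_suml sumr_delta sumr_const_natl card_p nn /f.
    rewrite /complete_bipartite_graph -/(p i) -/(p j) [j == i]eq_sym /=.
    have [-> | neq_ij] := eqVneq i j; first by rewrite !eqxx /=; field.
    by case: (p i == p j) => /=; field.
  move=> k /= ik; rewrite /f [j == k]eq_sym /=.
  have -> : (p k != p j) = (p i == p j).
    move: ik; rewrite /complete_bipartite_graph -/(p i) -/(p k).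
    by do 3!case: (p _).
  ring.
- by move=> i; rewrite /f !eqxx mulr0 subr0 mul1r.
Qed.

Theorem corollary4p2 (R : rcfType) :
  [/\ forall n : nat, (1 <= n)%N ->
        resistance_energy R (@complete_graph n) = 4 * (n%:R - 1) / n%:R,
      forall n : nat, (3 <= n)%N ->
        resistance_energy R (@cycle_graph n) = (n%:R ^+ 2 - 1) / 3
    & forall n : nat, (1 <= n)%N ->
        resistance_energy R (@complete_bipartite_graph n)
          = (8 * n%:R - 6) / n%:R].
Proof.
split; [exact: resistance_energy_complete | exact: resistance_energy_cycle |].
exact: resistance_energy_complete_bipartite.
Qed.
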